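(* Fix arbitrary parameters $\vec c=(c_0,\dots,c_n)\in\mathbb C^{n+1}$. The $n$-priority ASEP on the finite lattice $\Lambda_L$ is self-dual with respect to the duality function $$D(\zeta,\eta;\vec c)=\prod_{k=L^-}^{L^+}\prod_{\alpha=0}^n\Big(Q^\alpha_k(\eta)\,q^{c_\alpha(M^\alpha(\eta)-L)}\Big)^{n^\alpha_k(\zeta)},\qquad Q^\alpha_k(\eta)=m^\alpha_k(\eta)\,q^{M^\alpha_k(\eta)},$$ for configurations $\zeta,\eta\in\{0,\dots,n\}^{\Lambda_L}$.
   Context: Fix an integer $n\ge1$, reals $w>0$ and $q\ge1$, and integers $L^-,L^+$ with $L:=L^+-L^-+1\ge2$; put $\Lambda_L=\{L^-,\dots,L^+\}$. Configurations are $\eta=(\eta_k)_{k\in\Lambda_L}\in\{0,\dots,n\}^{\Lambda_L}$; $\eta^{kk+1}$ is $\eta$ with the values at $k$ and $k+1$ interchanged; $\operatorname{sgn}(0)=0$. The $n$-priority ASEP on $\Lambda_L$ is the continuous-time Markov chain with generator $$\mathcal Lf(\eta)=\sum_{k=L^-}^{L^+-1}w\big(q^{\operatorname{sgn}(\eta_k-\eta_{k+1})}-\delta_{\eta_k,\eta_{k+1}}\big)\,[f(\eta^{kk+1})-f(\eta)].$$ For $0\le\alpha\le n$: $n^\alpha_k(\eta)=\delta_{\eta_k,\alpha}$, $m^\alpha_k(\eta)=\sum_{\beta=\alpha}^nn^\beta_k(\eta)$ (the indicator of $\eta_k\ge\alpha$), $M^\alpha(\eta)=\sum_{k\in\Lambda_L}m^\alpha_k(\eta)$,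 and the particle balance $M^\alpha_k(\eta)=\sum_{l=L^-}^{k-1}m^\alpha_l(\eta)-\sum_{l=k+1}^{L^+}m^\alpha_l(\eta)$. Convention: $0^0=1$. Self-dual with respect to $D$ means that for all $\zeta,\eta$ and all $t\ge0$, $\mathbf E^\eta D(\zeta,\eta_t)=\mathbf E^\zeta D(\zeta_t,\eta)$, where $\eta_t$, $\zeta_t$ are $n$-priority ASEPs started from $\eta$, $\zeta$; equivalently $\mathcal L$ acting on $\eta\mapsto D(\zeta,\eta)$ and $\mathcal L$ acting on $\zeta\mapsto D(\zeta,\eta)$ give the same function of $(\zeta,\eta)$. *)

(* Defs.v *)
From HB Require Import structures.
From mathcomp Require Import all_boot all_order all_algebra.
From mathcomp Require Import all_classical all_reals all_analysis.
From mathcomp Require Import perm complex.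
Set Implicit Arguments.
Unset Strict Implicit.
Unset Printing Implicit Defensive.
Import Order.TTheory GRing.Theory Num.Theory.
Import numFieldNormedType.Exports.
Local Open Scope classical_set_scope.
Local Open Scope ring_scope.

(* The integers of [Lm, Lp], in increasing order; only meaningful when
   Lm <= Lp + 1, since absz is an absolute value. *)
Definition lattice (Lm Lp : int) : seq int :=
  [seq Lm + i%:Z | i <- iota 0 (absz (Lp - Lm + 1))].

Definition site (Lm Lp : int) : finType := seq_sub (lattice Lm Lp).

Definition config (n : nat) (Lm Lp : int) : finType :=
  {ffun site Lm Lp -> 'I_n.+1}.

Section Configurations.
Variables (n : nat) (Lm Lp : int).
Local Notation site := (site Lm Lp).
Local Notation config := (config n Lm Lp).
Implicit Types (eta : config) (k l : site) (alpha beta : 'I_n.+1).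

Definition swap eta k l : config := [ffun j => eta (tperm k l j)].

Definition occ alpha k eta : nat := (eta k == alpha).

Definition mocc alpha k eta : nat :=
  (\sum_(beta < n.+1 | alpha <= beta) occ beta k eta)%N.

Definition mtot alpha eta : nat := (\sum_(k : site) mocc alpha k eta)%N.

Definition mbal alpha k eta : int :=
  \sum_(l : site | (val l < val k)%R) (mocc alpha l eta)%:Z
  - \sum_(l : site | (val k < val l)%R) (mocc alpha l eta)%:Z.

Variables (R : realType) (w q : R).

Definition rate eta k l : R :=
  w * (q ^ sgz ((eta k)%:Z - (eta l)%:Z) - (eta k == eta l)%:R).

(* Acts on functions with values in any real vector space, so as to cover both
   real- and complex-valued functions.  The double sum ranges over the bonds
   (k, k+1), Lm <= k <= Lp - 1. *)
Definition generator (V : lmodType R) (f : config -> V) (eta : config) : V :=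
  \sum_(k : site) \sum_(l : site | val l == val k + 1)
    rate eta k l *: (f (swap eta k l) - f eta).

(* The entries of exp (t * generator), as a power series in t. *)
Definition transition (t : R) (eta xi : config) : R :=
  limn (series (fun j : nat => t ^+ j / j`!%:R *
    iter j (@generator R^o) (fun x => (x == xi)%:R) eta)).

(* The probability of visiting, in this order, the given (time, state) pairs,
   when starting from eta at time s. *)
Fixpoint path_prob (s : R) (eta : config) (p : seq (R * config)) : R :=
  if p is (t, xi) :: p' then transition (t - s) eta xi * path_prob t xi p'
  else 1.

(* X is a continuous-time Markov chain with the above generator, started from
   eta: its finite-dimensional distributions are given by path_prob.  The case
   p = [:: (0, eta)] says that X 0 = eta almost surely. *)
Definition priority_ASEP (d : measure_display) (T : measurableType d)
    (P : probability T R) (eta : config) (X : R -> T -> config) : Prop :=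
  (forall t xi, 0 <= t -> measurable [set a : T | X t a = xi]) /\
  (forall p : seq (R * config), path <=%R 0 (unzip1 p) ->
    P [set a : T | all (fun tx => X tx.1 a == tx.2) p]
    = (path_prob 0 eta p)%:E).

Definition cexpectation (d : measure_display) (T : measurableType d)
    (P : probability T R) (Z : T -> R[i]) : R[i] :=
  Complex (fine ('E_P[fun a => complex.Re (Z a)])%E)
          (fine ('E_P[fun a => complex.Im (Z a)])%E).

Definition self_dual (D : config -> config -> R[i]) : Prop :=
  forall (d d' : measure_display)
    (T : measurableType d) (T' : measurableType d')
    (P : probability T R) (P' : probability T' R)
    (zeta eta : config) (etat : R -> T -> config) (zetat : R -> T' -> config),
  priority_ASEP P eta etat -> priority_ASEP P' zeta zetat ->
  forall t : R, 0 <= t ->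
  cexpectation P (fun a => D zeta (etat t a))
  = cexpectation P' (fun a => D (zetat t a) eta).

(* Rcomplex R is R[i] as a vector space over R. *)
Definition generator_self_dual (D : config -> config -> R[i]) : Prop :=
  forall zeta eta : config,
  @generator (Rcomplex R) (fun xi => D zeta xi) eta
  = @generator (Rcomplex R) (fun xi => D xi eta) zeta.

(* q^z = exp (z ln q), for real q > 0 and complex z. *)
Definition cpow (z : R[i]) : R[i] :=
  (expR (complex.Re z * ln q))%:C%C *
  Complex (cos (complex.Im z * ln q)) (sin (complex.Im z * ln q)).

Definition Qfun alpha k eta : R := (mocc alpha k eta)%:R * q ^ mbal alpha k eta.

Definition duality_fun (c : 'I_n.+1 -> R[i]) (zeta eta : config) : R[i] :=
  let L : int := Lp - Lm + 1 in
  \prod_(k : site) \prod_(alpha < n.+1)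
    ((Qfun alpha k eta)%:C%C * cpow (c alpha * ((mtot alpha eta)%:Z - L)%:~R))
      ^+ occ alpha k zeta.

End Configurations.

(* Main.v *)
(* D = phase * qprod, where the phase involves only the conserved quantities
   M^alpha(eta) and the particle numbers of zeta, so it is invariant under
   exchanges in both arguments.  Exchanging two neighbours of zeta or of eta
   changes qprod only through the two sites of the bond, so the generator
   identity holds bond by bond and reduces to a finite check on the four values
   involved.  The identity passes to the semigroup because the generator acting
   on zeta commutes with the generator acting on eta, so all powers of the two
   agree on D, and hence so do the exponential series. *)
Require Import Defs.
From mathcomp Require Import all_boot all_order all_algebra.
From mathcomp Require Import all_classical all_reals all_analysis.
From mathcomp Require Import complex.
From mathcomp Require Import perm ring zify.
Import Order.TTheory GRing.Theory Num.Theory.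
Import numFieldNormedType.Exports.
Local Open Scope ring_scope.

(** * Occupation numbers and particle balances under an exchange on a bond *)

Section Configurations.
Context {n : nat} {Lm Lp : int}.
Implicit Types (zeta eta : config n Lm Lp) (j k l : site Lm Lp).
Implicit Types (alpha : 'I_n.+1).

Lemma swapE eta k l j : swap eta k l j = eta (tperm k l j).
Proof. by rewrite ffunE. Qed.

Lemma moccE alpha k eta : mocc alpha k eta = (alpha <= eta k)%N.
Proof.
rewrite /mocc /occ big_mkcond (bigD1 (eta k)) //= eqxx big1 ?addn0.
  by case: leqP.
by move=> i /negPf; rewrite eq_sym => ->; case: ifP.
Qed.

Lemma mocc_swap alpha k l j eta :
  mocc alpha j (swap eta k l) = mocc alpha (tperm k l j) eta.
Proof. by rewrite !moccE swapE. Qed.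

Lemma mtot_swap alpha k l eta : mtot alpha (swap eta k l) = mtot alpha eta.
Proof.
rewrite /mtot [RHS](reindex_inj (@perm_inj _ (tperm k l))) /=.
by apply: eq_bigr => j _; rewrite mocc_swap.
Qed.

(** A [P] that does not separate [k] from [l] is preserved by their transposition, so the exchange
    only reorders the sum. *)
Lemma sum_mocc_swap (P : pred (site Lm Lp)) alpha k l eta : P k = P l ->
  \sum_(j | P j) (mocc alpha j (swap eta k l))%:Z =
  \sum_(j | P j) (mocc alpha j eta)%:Z.
Proof.
move=> Pkl; rewrite [RHS](reindex_inj (@perm_inj _ (tperm k l))) /=.
apply: eq_big => [j|j _]; last by rewrite mocc_swap.
by case: tpermP => [->|->|].
Qed.

(* Hides the eqType structure under which the coordinate of a site is read,
   which differs between the order and the equality of [int]. *)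
Definition pos (j : site Lm Lp) : int := val j.

Lemma pos_inj : injective pos.
Proof. exact: val_inj. Qed.

Lemma mbalE alpha k eta : mbal alpha k eta =
  \sum_(j | pos j < pos k) (mocc alpha j eta)%:Z
  - \sum_(j | pos k < pos j) (mocc alpha j eta)%:Z.
Proof. by []. Qed.

Section Bond.
Variables k l : site Lm Lp.
Hypothesis kl : pos l = pos k + 1.

Lemma bond_neq : k != l.
Proof. by apply/eqP => e; move: kl; rewrite e; lia. Qed.

(* The particle balance of the complement of the bond {k, l}. *)
Definition outer_bal alpha eta : int :=
  \sum_(j | pos j < pos k) (mocc alpha j eta)%:Z
  - \sum_(j | pos l < pos j) (mocc alpha j eta)%:Z.

Lemma outer_bal_swap alpha eta :
  outer_bal alpha (swap eta k l) = outer_bal alpha eta.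
Proof. by rewrite /outer_bal !sum_mocc_swap // kl; lia. Qed.

Lemma mbal_left alpha eta :
  mbal alpha k eta = outer_bal alpha eta - (mocc alpha l eta)%:Z.
Proof.
rewrite mbalE /outer_bal [X in _ - X = _](bigD1 l) /=; last by lia.
rewrite opprD addrA addrAC; congr (_ - _ - _); apply: eq_bigl => j.
by rewrite -(inj_eq pos_inj); lia.
Qed.

Lemma mbal_right alpha eta :
  mbal alpha l eta = outer_bal alpha eta + (mocc alpha k eta)%:Z.
Proof.
rewrite mbalE /outer_bal [X in X - _ = _](bigD1 k) /=; last by lia.
rewrite -addrA addrC; congr (_ - _ + _); apply: eq_bigl => j.
by rewrite -(inj_eq pos_inj); lia.
Qed.

(** A third site has both ends of the bond on the same side, since [k] and [l] are adjacent. *)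
Lemma mbal_swap alpha j eta : j != k -> j != l ->
  mbal alpha j (swap eta k l) = mbal alpha j eta.
Proof.
rewrite -!(inj_eq pos_inj) => jk jl.
by rewrite !mbalE !sum_mocc_swap //; lia.
Qed.

End Bond.
End Configurations.

(** * The generator identity, from one bond to the whole lattice *)

Section GeneratorDuality.
Context {R : realType} {n : nat} {Lm Lp : int}.
Variables (w q : R) (c : 'I_n.+1 -> R[i]).
Hypothesis q0 : q != 0.
Implicit Types (zeta eta : config n Lm Lp) (j k l : site Lm Lp).

(* (a, b) and (x, y) are the values of zeta and eta on a bond. *)
Lemma two_site_duality (a b x y : nat) :
  let d (a b x y : nat) : R :=
    ((a <= x)%N && (b <= y)%N)%:R * q ^ ((b <= x)%N%:Z - (a <= y)%N%:Z) in
  let r (x y : nat) : R := w * (q ^ sgz (x%:Z - y%:Z) - (x == y)%:R) in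
  r x y * (d a b y x - d a b x y) = r a b * (d b a x y - d a b x y).
Proof.
(* The Kronecker delta cancels [q ^ 0] at equal values, so only the rates [q], [q^-1] and 0
   occur. *)
have rE (u v : nat) : q ^ sgz (u%:Z - v%:Z) - (u == v)%:R =
    if (u < v)%N then q^-1 else if (v < u)%N then q else 0.
  case: ltngtP => [uv|uv|->].
  - by rewrite ltr0_sgz ?subr0 //; lia.
  - by rewrite gtr0_sgz ?subr0 //; lia.
  - by rewrite subrr sgz0 subrr.
move=> d r; rewrite /d /r !rE -!mulrA; congr (_ * _).
have qB (s t : bool) : q ^ (s%:Z - t%:Z) =
    (if s then q else 1) * (if t then q^-1 else 1).
  by rewrite expfzDr //; case: s; case: t.
rewrite !qB.
(* Both sides depend only on the relative order of the four values; each consistent order leaves a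
   rational identity in [q]. *)
case: (ltngtP a b) => ab; case: (ltngtP x y) => xy;
  rewrite ?ab ?xy ?mul0r ?subrr ?mulr0 //;
  case: (leqP a x) => ax; case: (leqP b y) => by_; try (exfalso; lia);
  case: (leqP a y) => ay; try (exfalso; lia);
  case: (leqP b x) => bx; try (exfalso; lia); rewrite /=.
all: by field.
Qed.

Definition qprod zeta eta : R := \prod_j Qfun q (zeta j) j eta.

Definition phase zeta eta : R[i] :=
  \prod_j cpow q (c (zeta j) *
                  ((mtot (zeta j) eta)%:Z - (Lp - Lm + 1))%:~R).

(** At each site the exponents [occ] select the factor with [alpha] equal to the value of [zeta];
    the others are zeroth powers, equal to 1 even where [Qfun] vanishes. *)
Lemma duality_funE zeta eta :
  duality_fun q c zeta eta = (qprod zeta eta)%:C%C * phase zeta eta.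
Proof.
rewrite /qprod rmorph_prod -big_split; apply: eq_bigr => j _ /=.
rewrite (bigD1 (zeta j)) //= big1 => [|i /negPf ij].
  by rewrite /occ eqxx expr1 mulr1.
by rewrite /occ eq_sym ij expr0.
Qed.

Lemma phase_swapl zeta eta k l : phase (swap zeta k l) eta = phase zeta eta.
Proof.
rewrite /phase [RHS](reindex_inj (@perm_inj _ (tperm k l))) /=.
by apply: eq_bigr => j _; rewrite swapE.
Qed.

Lemma phase_swapr zeta eta k l : phase zeta (swap eta k l) = phase zeta eta.
Proof. by apply: eq_bigr => j _; rewrite mtot_swap. Qed.

Lemma bond_duality zeta eta k l : pos l = pos k + 1 ->
  rate w q eta k l * (qprod zeta (swap eta k l) - qprod zeta eta) =
  rate w q zeta k l * (qprod (swap zeta k l) eta - qprod zeta eta).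
Proof.
move=> kl; have knl := bond_neq k l kl.
pose E alpha := outer_bal k l alpha eta.
pose d (a b x y : nat) : R :=
  ((a <= x)%N && (b <= y)%N)%:R * q ^ ((b <= x)%N%:Z - (a <= y)%N%:Z).
pose rest (z e : config n Lm Lp) :=
  \prod_(j | (j != k) && (j != l)) Qfun q (z j) j e.
(* Stated for every [e] with the outer balances of [eta], so that it covers both [eta] and its
   exchange; [d] collects what depends on the bond alone. *)
have qprodE z e : (forall alpha, outer_bal k l alpha e = E alpha) ->
    qprod z e = rest z e * q ^ (E (z k) + E (z l)) * d (z k) (z l) (e k) (e l).
  move=> eE; rewrite /qprod (bigD1 k) //= (bigD1 l) 1?eq_sym //=.
  rewrite -/(rest z e) /Qfun !(mbal_left _ _ kl, mbal_right _ _ kl) !moccE !eE.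
  rewrite /d -mulnb natrM !expfzDr //.
  by do ![move: (q ^ _) => ?]; do ![move: (_%:R) => ?]; ring.
have restr : rest zeta (swap eta k l) = rest zeta eta.
  apply: eq_bigr => j /andP[jk jl]; rewrite /Qfun mbal_swap // mocc_swap.
  by rewrite tpermD 1?eq_sym.
have restl : rest (swap zeta k l) eta = rest zeta eta.
  by apply: eq_bigr => j /andP[jk jl]; rewrite swapE tpermD 1?eq_sym.
have E_swap alpha : outer_bal k l alpha (swap eta k l) = E alpha.
  exact: outer_bal_swap.
rewrite !qprodE //.
(* The exponent of the outer factor is symmetric in the two values of [zeta], so this factor is
   common to all terms. *)
rewrite restr restl !swapE !tpermL !tpermR [E (zeta l) + _]addrC -!mulrBr.
rewrite [LHS]mulrCA [RHS]mulrCA; congr (_ * _).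
have := two_site_duality (zeta k) (zeta l) (eta k) (eta l).
by rewrite /= -/(d _ _ _ _).
Qed.

Lemma Rcomplex_scaleE (a : R) (z : Rcomplex R) : a *: z = a%:C%C * z.
Proof.
by case: z => x y; apply/eqP; rewrite eq_complex /= !mul0r subr0 addr0 !eqxx.
Qed.

Lemma generator_duality : generator_self_dual w q (@duality_fun n Lm Lp R q c).
Proof.
move=> zeta eta; apply: eq_bigr => k _; apply: eq_bigr => l kl.
have kl' : pos l = pos k + 1 by exact/eqP.
rewrite !duality_funE phase_swapl phase_swapr -!mulrBl -!rmorphB.
by rewrite !Rcomplex_scaleE !mulrA -!rmorphM /= bond_duality.
Qed.
End GeneratorDuality.

(** * From the generator to its exponential series *)

Section Semigroup.
Context {R : realType} {n : nat} {Lm Lp : int}.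
Variables (w q : R).
Local Notation config := (config n Lm Lp).
Implicit Types (zeta eta xi : config) (f : config -> R).
Implicit Types (D : config -> config -> R).

Let gen : (config -> R) -> config -> R := @generator n Lm Lp R w q R^o.
Let delta xi : config -> R := fun x => (x == xi)%:R.

Lemma generator_sum (I : finType) (a : I -> R) (F : I -> config -> R) eta :
  gen (fun x => \sum_i a i * F i x) eta = \sum_i a i * gen (F i) eta.
Proof.
under [RHS]eq_bigr do rewrite mulr_sumr; rewrite exchange_big.
apply: eq_bigr => k _.
under [RHS]eq_bigr do rewrite mulr_sumr; rewrite exchange_big.
apply: eq_bigr => l _; rewrite -sumrB scaler_sumr; apply: eq_bigr => i _.
by rewrite -mulrBr /GRing.scale /= mulrCA.
Qed.

Lemma iter_generator_sum (I : finType) (a : I -> R) (F : I -> config -> R) j :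
  iter j gen (fun x => \sum_i a i * F i x) =
  (fun x => \sum_i a i * iter j gen (F i) x).
Proof.
by elim: j => //= j ->; apply/funext => x; exact: generator_sum.
Qed.

Lemma delta_expansion f : f = (fun x => \sum_xi f xi * delta xi x).
Proof.
apply/funext => x; rewrite (bigD1 x) //= big1 => [|xi /negPf xix].
  by rewrite /delta eqxx mulr1 addr0.
by rewrite /delta eq_sym xix mulr0.
Qed.

Lemma iter_generator_expansion f j eta :
  iter j gen f eta = \sum_xi f xi * iter j gen (delta xi) eta.
Proof. by rewrite [in LHS](delta_expansion f) iter_generator_sum. Qed.

Lemma generator_expansion f eta :
  gen f eta = \sum_xi f xi * gen (delta xi) eta.
Proof. exact: (iter_generator_expansion f 1). Qed.

(** The action on [zeta] is a finite combination with coefficients free of [eta], so linearity moves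
    it inside the action on [eta]. *)
Lemma generator_comm D zeta eta :
  gen (fun y => gen (D^~ y) zeta) eta = gen (fun x => gen (D x) eta) zeta.
Proof.
rewrite [RHS]generator_expansion.
under [RHS]eq_bigr do rewrite mulrC.
rewrite -generator_sum; congr (gen _ eta); apply/funext => y.
rewrite generator_expansion.
by under eq_bigr do rewrite mulrC.
Qed.

Lemma iter_generator_duality D j :
  (forall zeta eta, gen (D zeta) eta = gen (D^~ eta) zeta) ->
  forall zeta eta, iter j gen (D zeta) eta = iter j gen (D^~ eta) zeta.
Proof.
elim: j D => // j IH D hD zeta eta; rewrite !iterSr.
have -> : gen (D^~ eta) = (fun x => gen (D x) eta).
  by apply/funext => x; rewrite hD.
(* [D] is replaced by its image under the generator, which is again self-dual by commutation. *)
apply: (IH (fun x y => gen (D x) y)) => x y.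
by rewrite -generator_comm; congr (gen _ y); apply/funext => z.
Qed.

(** It dominates every absolute row sum of the generator matrix, hence its operator norm for the
    supremum norm. *)
Let genbound : R := \sum_eta \sum_xi `|gen (delta xi) eta|.

Lemma iter_generator_bound f j eta : (forall x, `|f x| <= 1) ->
  `|iter j gen f eta| <= genbound ^+ j.
Proof.
move=> f1; elim: j eta => [|j IH] eta; first by rewrite expr0.
rewrite iterS generator_expansion exprSr.
apply: le_trans (ler_norm_sum _ _ _) _.
under eq_bigr do rewrite normrM.
apply: (@le_trans _ _ (\sum_xi genbound ^+ j * `|gen (delta xi) eta|)).
  by apply: ler_sum => xi _; rewrite ler_wpM2r.
rewrite -mulr_sumr ler_wpM2l //.
  by apply: le_trans (IH eta).
rewrite /genbound [leRHS](bigD1 eta) //= lerDl.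
by apply: sumr_ge0 => x _; apply: sumr_ge0.
Qed.

Let exp_term t f eta (j : nat) : R := t ^+ j / j`!%:R * iter j gen f eta.

(** Absolute convergence, by comparison with the exponential series at [|t| * genbound]. *)
Lemma cvg_exp_generator t xi eta : cvgn (series (exp_term t (delta xi) eta)).
Proof.
apply: normed_cvg.
apply: (@series_le_cvg _ _ (exp_coeff (`|t| * genbound))) => [j|j|j|].
- by rewrite /= normr_ge0.
- by rewrite exp_coeff_ge0 // mulr_ge0 // sumr_ge0 // => x _; rewrite sumr_ge0.
- rewrite /exp_term /exp_coeff /= !normrM normfV normr_nat normrX exprMn.
  rewrite mulrAC ler_wpM2r // ler_wpM2l ?exprn_ge0 //.
  by apply: iter_generator_bound => x; rewrite /delta; case: eqP;
  rewrite ?normr1 ?normr0.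
- exact: is_cvg_series_exp_coeff.
Qed.

(** Expanding [f] in indicators gives a finite sum over [xi], which may be exchanged with the limit
    since each series converges. *)
Lemma transition_sum t f eta :
  \sum_xi f xi * transition w q t eta xi = limn (series (exp_term t f eta)).
Proof.
have -> : series (exp_term t f eta) =
    (fun m => \sum_xi f xi * series (exp_term t (delta xi) eta) m).
  apply/funext => m; rewrite /series /=.
  under [RHS]eq_bigr do rewrite mulr_sumr; rewrite exchange_big.
  apply: eq_bigr => j _; rewrite /exp_term iter_generator_expansion mulr_sumr.
  by apply: eq_bigr => xi _; rewrite mulrCA.
apply/esym/cvg_lim => //.
apply: cvg_big => [|xi _]; first exact: add_continuous.
by apply: cvgM; [exact: cvg_cst|exact: cvg_exp_generator].
Qed.

Lemma transition_duality D t zeta eta :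
  (forall zeta eta, gen (D zeta) eta = gen (D^~ eta) zeta) ->
  \sum_xi D zeta xi * transition w q t eta xi =
  \sum_xi D xi eta * transition w q t zeta xi.
Proof.
move=> hD; rewrite transition_sum [RHS](transition_sum t (D^~ eta)).
congr (limn (series _)); apply/funext => j.
by rewrite /exp_term iter_generator_duality.
Qed.

End Semigroup.

(** * From the semigroup to expectations of the process *)

Section Expectation.
Local Open Scope classical_set_scope.
Context {R : realType} {d : measure_display} {T : measurableType d}.
Variables (P : probability T R) (I : finType) (X : T -> I).
Hypothesis mX : forall i, measurable [set a : T | X a = i].

Lemma expectation_finite_range (f : I -> R) :
  ('E_P[fun a => f (X a)] = \sum_i (f i)%:E * P [set a : T | X a = i])%E.
Proof.
rewrite unlock.
have intX i : P.-integrable [set: T] (EFin \o \1_[set a : T | X a = i]).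
  exact: integrable_indic.
transitivity (\int[P]_a (\sum_i ((f i)%:E * (\1_[set a : T | X a = i] a)%:E)))%E.
  apply: eq_integral => a _; rewrite (bigD1 (X a)) //= big1 => [|i /eqP iX].
    by rewrite indicE mem_set //= mule1 adde0.
  by rewrite indicE memNset ?mule0 // => /esym.
rewrite integral_sum // => [|i]; last by apply: integrableZl => //; exact: intX.
apply: eq_bigr => i _; rewrite integralZl //; last exact: intX.
by rewrite integral_indic // setIT.
Qed.
End Expectation.

Lemma expectation_priority_ASEP {R : realType} {n : nat} {Lm Lp : int} (w q : R)
    d (T : measurableType d) (P : probability T R) (eta : config n Lm Lp) X t f :
  priority_ASEP w q P eta X -> 0 <= t ->
  'E_P[fun a => f (X t a)]%E = (\sum_xi f xi * transition w q t eta xi)%:E.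
Proof.
move=> [mX pX] t0; rewrite expectation_finite_range => [|xi]; last exact: mX.
rewrite -sumEFin; apply: eq_bigr => xi _; rewrite EFinM; congr (_ * _)%E.
(* A path with a single entry gives the law at time [t]. *)
have := pX [:: (t, xi)]; rewrite /= t0 subr0 mulr1 => <- //.
by congr (P _); apply/seteqP; split => a /=; rewrite andbT => /eqP.
Qed.

Lemma linear_generator {R : realType} {n : nat} {Lm Lp : int} (w q : R)
    (V W : lmodType R) (g : {linear V -> W}) (f : config n Lm Lp -> V) eta :
  generator w q (fun x => g (f x)) eta = g (generator w q f eta).
Proof.
rewrite /generator linear_sum; apply: eq_bigr => k _; rewrite linear_sum.
by apply: eq_bigr => l _; rewrite linearZ /= (linearB g).
Qed.

Lemma generator_self_dual_self_dual {R : realType} {n : nat} {Lm Lp : int}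
    (w q : R) (D : config n Lm Lp -> config n Lm Lp -> R[i]) :
  generator_self_dual w q D -> self_dual w q D.
Proof.
move=> hD d d' T T' P P' zeta eta etat zetat hP hP' t t0.
(* Real and imaginary parts are real-linear, so they commute with the generator and the real-valued
   semigroup argument applies to each. *)
have part (g : {linear Rcomplex R -> R^o}) x y :
    @generator _ _ _ _ w q R^o (fun xi => g (D x xi)) y =
    @generator _ _ _ _ w q R^o (fun xi => g (D xi y)) x.
  by rewrite (linear_generator w q _ _ g (D x)) hD -linear_generator.
have partE (g : {linear Rcomplex R -> R^o}) :
    fine 'E_P[fun a => g (D zeta (etat t a))]%E =
    fine 'E_P'[fun a => g (D (zetat t a) eta)]%E.
  rewrite (expectation_priority_ASEP _ _ _ _ _ _ _ _ (fun x => g (D zeta x)) hP) //.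
  rewrite (expectation_priority_ASEP _ _ _ _ _ _ _ _ (fun x => g (D x eta)) hP') //=.
  exact: (transition_duality w q (fun x y => g (D x y)) t zeta eta (part g)).
congr Complex; [exact: (partE (@complex.Re R)) | exact: (partE (@complex.Im R))].
Qed.

Theorem theorem3p5 (R : realType) (n : nat) (Lm Lp : int) (w q : R)
    (c : 'I_n.+1 -> R[i]) :
  (1 <= n)%N -> 2%:Z <= Lp - Lm + 1 -> 0 < w -> 1 <= q ->
  self_dual w q (@duality_fun n Lm Lp R q c) /\
  generator_self_dual w q (@duality_fun n Lm Lp R q c).
Proof.
move=> _ _ _ q1; have q0 : q != 0 by rewrite gt_eqF // (lt_le_trans ltr01 q1).
have gen_dual := generator_duality w q c q0.
by split=> //; exact: generator_self_dual_self_dual.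
Qed.
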